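(* Let $C>0$ be fixed. There exist constants $K>0$ and $n_0\ge 3$, depending only on $C$, such that for every integer $n\ge n_0$, all $C$-log-sparse sets $S_1,\dots,S_n\subset\mathbb{Z}_{>0}$, and every arithmetic progression $T$ contained in the sumset $S=S_1+\cdots+S_n$, one has $$|T|\le n^{\left(1+K\,\frac{\log_2\log_2 n}{\log_2 n}\right)n}.$$
   Context: A subset $A\subset\mathbb{Z}_{>0}$ is $C$-log-sparse if $|A\cap[x,2x)|\le C$ for every positive integer $x$. The sumset $S_1+\cdots+S_n$ of sets $S_1,\dots,S_n\subset\mathbb{Z}_{>0}$ is the set of all positive integers of the form $x_1+\cdots+x_n$ with $x_i\in S_i$ for every $i$. An arithmetic progression of length (size) $k$ is a set $\{a,a+d,\dots,a+(k-1)d\}$ with $a$ and $d\geq 1$ integers. *)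

(* Defs.v *)
From mathcomp Require Export all_boot all_order all_algebra finmap.
From mathcomp Require Export all_classical all_reals all_analysis.

Set Implicit Arguments.
Unset Strict Implicit.
Unset Printing Implicit Defensive.

Import Order.TTheory GRing.Theory Num.Theory.

Local Open Scope classical_set_scope.
Local Open Scope ring_scope.

(* [fset_set] returns the empty set on infinite sets; the intersection below
   is always finite. *)
Definition log_sparse (R : realType) (C : R) (A : set nat) : Prop :=
  forall x : nat, (0 < x)%N ->
    (#|` fset_set (A `&` [set m | (x <= m < 2 * x)%N])|)%:R <= C.

(* For n > 0 and sets of positive integers, every such sum is positive. *)
Definition sumset (n : nat) (S : 'I_n -> set nat) : set nat :=
  [set m | exists2 x : 'I_n -> nat,
    (forall i, S i (x i)) & m = (\sum_(i < n) x i)%N].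

(* A nonempty progression lying in a set of positive integers starts at a
   positive integer, so [a : nat] loses nothing there. *)
Definition arithmetic_progression (T : set nat) : Prop :=
  exists a d k : nat, (0 < d)%N /\ T = [set (a + i * d)%N | i in `I_k].

Definition log2 (R : realType) (x : R) : R := ln x / ln 2.

(* Main.v *)
Require Import Defs.
From mathcomp Require Import zify.
Import Order.TTheory GRing.Theory Num.Theory.

(** Why the theorem is true. Let the progression have [k] terms and common
    difference [d], and let it start at [a]. The number [k] is bounded by
    counting the ways to choose, one at a time, the summands of its terms;
    a partial choice is recorded by the set [I] of indices still free and by
    the sum [c] of the summands already chosen. All terms of the progression
    lie in a window of length [k * d], so what remains to be represented lies
    between [a - c] and [a - c + k * d].

    If [a - c > k * d], then some free summand is at least [(a - c) / n], and
    none exceeds [2 * (a - c)]. Naming the index of that summand costs a factor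
    [n], and naming its value costs only [O(log n)], because log-sparseness
    leaves [O(log n)] elements in an interval whose endpoints have ratio
    [O(n)].

    If [a - c <= k * d], then every remaining summand is below [2 * k * d]. The
    indices can now be taken in a fixed order: each summand is either below
    [d / n] or one of the [O(log (n * k))] elements of its set between [d / n]
    and [2 * k * d]. Only the latter need to be named, because the small
    summands add up to less than [d] and therefore cannot tell two terms of the
    progression apart.

    Each summand thus costs a factor [n * O(log n)] or [O(log (n * k))], whence
    [k <= max (O(log (n * k)), n * O(log n)) ^ n] ([sumset_count]). Since [k]
    enters the right-hand side only through its logarithm, this inequality
    improves itself to [k <= (n * O(log n)) ^ n] ([bootstrap_bound]). Finally
    [O(log n) <= (log2 n) ^ K] for a constant [K], and [(n * (log2 n) ^ K) ^ n]
    is the bound of the theorem ([powR_log2_ratio]). *)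

Set Implicit Arguments.
Unset Strict Implicit.
Unset Printing Implicit Defensive.

Local Open Scope nat_scope.

(** * Spaced sequences and sparse sets *)

Definition spaced (d : nat) : seq nat -> bool :=
  pairwise (fun m m' => m + d <= m').

(** Sparseness is witnessed by a list, so that the elements of [A] in the
    interval can be named by their positions in it. *)
Definition few_in (A : set nat) (W lo hi : nat) : Prop :=
  exists2 s : seq nat, size s <= W &
    forall y, A y -> lo <= y < hi -> y \in s.

Lemma few_in_mul2X (A : set nat) (M lo L : nat) :
  0 < lo -> (forall x, 0 < x -> few_in A M x (2 * x)) ->
  few_in A (M * L) lo (2 ^ L * lo).
Proof.
move=> lo_gt0 fewA; elim: L => [|L [s sz_s sP]].
  by exists [::] => // y _; lia.
have [|s' sz_s' s'P] := fewA (2 ^ L * lo).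
  by rewrite muln_gt0 expn_gt0.
exists (s ++ s'); first by rewrite size_cat; lia.
move=> y Ay; rewrite expnS mem_cat => y_in.
have [y_lt|y_ge] := ltnP y (2 ^ L * lo).
  by rewrite sP //; lia.
by rewrite (s'P y) ?orbT //; lia.
Qed.

(** The counting principle behind both kinds of choices: [j] ranges over the
    possible choices, and a bound is needed only for the elements compatible
    with a fixed choice. Passing to subsequences lets them inherit [spaced]. *)
Lemma leq_size_cover (J : finType) (P : J -> nat -> Prop) (X : seq nat)
    (b : nat) :
  (forall m, m \in X -> exists j, P j m) ->
  (forall j Y, subseq Y X -> (forall m, m \in Y -> P j m) -> size Y <= b) ->
  size X <= #|J| * b.
Proof.
move=> coverX boundP.
have: size X <= \sum_(j : J) count (fun m => `[< P j m >]) X.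
  under eq_bigr do rewrite -sum1_count big_mkcond.
  rewrite exchange_big /= -sum1_size !big_seq; apply: leq_sum => m mX.
  have [j /asboolP Pjm] := coverX m mX.
  by rewrite (bigD1 j) //= Pjm.
move/leq_trans; apply; rewrite -sum_nat_const leq_sum // => j _.
rewrite -size_filter; apply: (boundP j); first exact: filter_subseq.
by move=> m; rewrite mem_filter => /andP[/asboolP].
Qed.

Lemma spaced_interval_size (d c : nat) (X : seq nat) :
  spaced d X -> (forall m, m \in X -> c <= m < c + d) -> size X <= 1.
Proof.
case: X => [|m [|m' X]] //= /andP[/andP[mm' _] _] Xc.
have := Xc m; have := Xc m'; rewrite !inE !eqxx orbT => /(_ isT) + /(_ isT).
lia.
Qed.

Lemma ceil_div_spec (n e : nat) : 0 < n -> 0 < e ->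
  let lo := ((e - 1) %/ n).+1 in
  [/\ 0 < lo, e <= n * lo & forall y, y < lo -> n * y < e].
Proof.
move=> n_gt0 e_gt0 lo; split=> //.
  have := ltn_ceil (e - 1) n_gt0; rewrite -/lo; lia.
move=> y; rewrite ltnS leq_divRL //; lia.
Qed.

(** * Counting the representations *)

Section Counting.
Variables (n d : nat) (S : 'I_n -> set nat).
Hypotheses (n_gt0 : 0 < n) (d_gt0 : 0 < d).

(** The number [r] is the sum of the summands discarded as small, one for each
    index outside [I] at most, and each at most [(d - 1) / n]; hence the budget
    [n * r <= (n - #|I|) * (d - 1)], written without subtraction. *)
Definition residual_sum (H : nat) (I : {set 'I_n}) (c m : nat) : Prop :=
  exists (r : nat) (x : 'I_n -> nat),
    [/\ forall i, i \in I -> S i (x i) /\ x i < H,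
        n * r + #|I| * (d - 1) <= n * (d - 1)
      & m = c + r + \sum_(i in I) x i].

(** Each index of [I] offers [W] large values or the option of being discarded.
    Once [I] is exhausted the budget gives [r < d], so the remaining elements
    lie in an interval of length [d], which holds only one of them. *)
Lemma residual_sum_count (W lo H : nat) (I : {set 'I_n}) (c : nat)
    (X : seq nat) :
  (forall i, few_in (S i) W lo H) -> (forall y, y < lo -> n * y < d) ->
  spaced d X -> (forall m, m \in X -> residual_sum H I c m) ->
  size X <= (1 + W) ^ #|I|.
Proof.
move=> fewS lo_small; have [k] := ubnP #|I|.
elim: k => // k IHk in I c X *; rewrite ltnS => leIk spX XI.
have [I0|[i iI]] := set_0Vmem I.
  rewrite I0 cards0; apply: (@spaced_interval_size d c) => // m /XI.
  case=> r [x [_]]; rewrite I0 cards0 big_set0 => r_le ->.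
  have: r <= d - 1 by rewrite -(leq_pmul2l n_gt0); lia.
  lia.
have cardI : #|I| = #|I :\ i|.+1 by rewrite (cardsD1 i I) iI.
have [s sz_s sP] := fewS i.
(* [None] stands for a small summand, which is moved into [r]. *)
pose step (o : option 'I_W) := if o is Some j then nth 0 s j else 0.
rewrite cardI expnS.
have -> : 1 + W = #|{: option 'I_W}| by rewrite card_option card_ord.
apply: (leq_size_cover
  (P := fun o m => residual_sum H (I :\ i) (c + step o) m)); last first.
  move=> o Y sYX YP; rewrite card_option card_ord.
  apply: IHk YP; first by rewrite -cardI.
  exact: subseq_pairwise sYX spX.
move=> m /XI[r [x [xS r_le ->]]]; have [Sx xH] := xS i iI.
rewrite (big_setD1 i iI) /=.
have xS' j : j \in I :\ i -> S j (x j) /\ x j < H.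
  by case/setD1P => _ /xS.
have [x_lt|x_ge] := ltnP (x i) lo.
  exists None, (r + x i), x; split=> //; last by rewrite /=; lia.
  by have := lo_small _ x_lt; rewrite cardI in r_le; lia.
have xs : x i \in s by apply: sP; rewrite ?x_ge.
have lt_iW : index (x i) s < W by rewrite (leq_trans _ sz_s) // index_mem.
exists (Some (Ordinal lt_iW)), r, x; split=> //.
  by rewrite cardI in r_le; lia.
by rewrite /= nth_index //; lia.
Qed.

Variables (M k L L' : nat).
Hypotheses (sparse : forall i x, 0 < x -> few_in (S i) M x (2 * x))
  (kL : 2 * (n * k) <= 2 ^ L) (nL' : 2 * n <= 2 ^ L').

(** The induction removes a large summand while [a] exceeds [c] by more than the
    length [k * d] of the window, and hands over to [residual_sum_count] as soon
    as it does not. Keeping [c] as an offset, rather than translating [X],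
    leaves the window and the spacing unchanged throughout. *)
Lemma sumset_count (I : {set 'I_n}) (a c : nat) (X : seq nat) :
  spaced d X -> (forall m, m \in X -> a <= m < a + k * d) ->
  (forall m, m \in X -> exists2 x : 'I_n -> nat,
     (forall i, i \in I -> S i (x i)) & m = c + \sum_(i in I) x i) ->
  size X <= maxn (1 + M * L) (n * (M * L')) ^ #|I|.
Proof.
have [p] := ubnP #|I|.
elim: p => // p IHp in I c X *; rewrite ltnS => leIp spX Xa XI.
have [near_a|far_a] := leqP a (c + k * d).
  have [lo_gt0 d_le lo_small] := ceil_div_spec n_gt0 d_gt0.
  set lo := (_ %/ _).+1 in lo_gt0 d_le lo_small.
  have fewS i : few_in (S i) (M * L) lo (2 ^ L * lo).
    by apply: few_in_mul2X => // x; apply: sparse.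
  apply: (leq_trans (n := (1 + M * L) ^ #|I|)); last first.
    by case: (#|I|) => // q; rewrite leq_exp2r // leq_maxl.
  apply: (residual_sum_count (c := c) fewS) => // m mX.
  have [x xS m_eq] := XI m mX; exists 0, x; split; last 2 first.
  - have := max_card (mem I); rewrite card_ord muln0 add0n => leIn.
    by rewrite leq_mul2r leIn orbT.
  - by rewrite addn0.
  move=> i iI; split; first exact: xS.
  have x_le : x i <= \sum_(j in I) x j by rewrite (bigD1 i iI) leq_addr.
  have x_lt : x i < 2 * (k * d) by have := Xa m mX; lia.
  apply: (leq_trans x_lt); apply: leq_trans (leq_mul kL (leqnn lo)).
  by have := leq_mul (leqnn (2 * k)) d_le; lia.
(* From here on all sums lie in [e, 2 * e[. *)
pose e := a - c; have e_gt0 : 0 < e by rewrite /e; lia.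
have [lo_gt0 e_le lo_small] := ceil_div_spec n_gt0 e_gt0.
set lo := (_ %/ _).+1 in lo_gt0 e_le lo_small.
have fewS i : few_in (S i) (M * L') lo (2 * e).
  have [s sz_s sP] := few_in_mul2X L' lo_gt0 (@sparse i).
  exists s => // y Sy y_in; apply: sP => //.
  by have := leq_mul nL' (leqnn lo); lia.
have [s s_sz sP] : exists2 s : 'I_n -> seq nat, forall i, size (s i) <= M * L' &
    forall i y, S i y -> lo <= y < 2 * e -> y \in s i.
  have /choice[s sP] : forall i, exists s : seq nat, size s <= M * L' /\
      forall y, S i y -> lo <= y < 2 * e -> y \in s.
    by move=> i; have [s] := fewS i; exists s.
  by exists s => i; have [] := sP i.
have big_term m : m \in X -> exists (i : 'I_n) (x : 'I_n -> nat),
    [/\ i \in I, forall i, i \in I -> S i (x i), lo <= x i < 2 * e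
      & m = c + \sum_(i in I) x i].
  move=> mX; have [x xS m_eq] := XI m mX; have m_in := Xa m mX.
  have [[i /andP[iI x_ge]]|none] := pselect (exists i, (i \in I) && (lo <= x i)).
    exists i, x; split=> //.
    have x_le : x i <= \sum_(j in I) x j by rewrite (bigD1 i iI) leq_addr.
    by rewrite x_ge /=; move: m_in x_le; rewrite m_eq /e; lia.
  (* Otherwise the sum would be smaller than [e]. *)
  have: n * \sum_(i in I) x i <= \sum_(i in I) (e - 1).
    rewrite big_distrr; apply: leq_sum => i iI.
    have: x i < lo.
      by rewrite ltnNge; apply/negP => x_ge; apply: none; exists i; rewrite iI.
    by move/lo_small => /=; lia.
  rewrite sum_nat_const => sum_le.
  have := max_card (mem I); rewrite card_ord => leIn.
  have e_le_sum : n * e <= n * \sum_(i in I) x i by rewrite leq_mul2l /e; lia.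
  have := leq_trans e_le_sum (leq_trans sum_le (leq_mul leIn (leqnn _))).
  by rewrite leq_pmul2l //; lia.
(* The exponent can drop only if [I] is not empty, which a member of [X]
   guarantees. *)
have [X0|[m0 m0X]] : X = [::] \/ exists m, m \in X.
  by case: (X) => [|m Y]; [left|right; exists m; rewrite mem_head].
  by rewrite X0.
have cardI i : i \in I -> #|I| = #|I :\ i|.+1.
  by move=> iI; rewrite (cardsD1 i I) iI.
have [i0 [_ [i0I _ _ _]]] := big_term m0 m0X.
apply: (leq_trans (n := n * (M * L') *
    maxn (1 + M * L) (n * (M * L')) ^ #|I :\ i0|)); last first.
  by rewrite (cardI i0) // expnS leq_mul2r leq_maxr orbT.
have cardJ : #|{: 'I_n * 'I_(M * L')}| = n * (M * L').
  by rewrite card_prod !card_ord.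
rewrite -[X in X * _]cardJ.
apply: (leq_size_cover (P := fun (ij : 'I_n * 'I_(M * L')) m =>
  ij.1 \in I /\ exists2 x : 'I_n -> nat,
    forall i, i \in I :\ ij.1 -> S i (x i)
  & m = c + nth 0 (s ij.1) ij.2 + \sum_(i in I :\ ij.1) x i)).
  move=> m /big_term[i [x [iI xS x_in ->]]].
  have xs : x i \in s i by apply: sP => //; apply: xS.
  have lt_j : index (x i) (s i) < M * L'.
    by rewrite (leq_trans _ (s_sz i)) // index_mem.
  exists (i, Ordinal lt_j); split=> //=; exists x.
    by move=> j /setD1P[_ /xS].
  by rewrite nth_index // (big_setD1 i iI) /= addnA.
move=> [i j] [//|m1 Y] sYX YP.
have [iI _] := YP m1 (mem_head _ _).
have <- : #|I :\ i| = #|I :\ i0| by apply: succn_inj; rewrite -!cardI.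
apply: (IHp _ (c + nth 0 (s i) j) (m1 :: Y)); first by rewrite -cardI.
- exact: subseq_pairwise sYX spX.
- by move=> m /(mem_subseq sYX)/Xa.
by move=> m /YP[].
Qed.

End Counting.

(** * Solving the inequality for k *)

Lemma sqr_le_exp2S (u : nat) : u * u <= 2 ^ u.+1.
Proof.
have [|u_ge] := ltnP u 4; first by case: u => [|[|[|[|]]]].
rewrite -(subnKC u_ge); elim: (u - 4) => // v IHv.
rewrite addnS expnS; nia.
Qed.

(** The unknown to solve for is [t], the least integer with [k <= (n * t) ^ n].
    By minimality the hypothesis becomes [t <= O(M * (log n + log t))]. If
    [log t <= log n] this is the claim; otherwise [t <= O(M * log t)], and
    comparing with the exponential growth of [t] in [log t] bounds [t] by
    [O(M ^ 2)]. *)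
Lemma bootstrap_bound (M n k : nat) :
  0 < M -> 1 < n ->
  (forall L L', 2 * (n * k) <= 2 ^ L -> 2 * n <= 2 ^ L' ->
     k <= maxn (1 + M * L) (n * (M * L')) ^ n) ->
  k <= (n * (100 * M ^ 2 * up_log 2 n)) ^ n.
Proof.
move=> M_gt0 n_gt1 k_le.
have n_gt0 : 0 < n by lia.
set l := up_log 2 n.
have l_gt0 : 0 < l by rewrite up_log_gt0.
have nl : n <= 2 ^ l by apply: up_logP.
have ex_t : exists t, k <= (n * t) ^ n.
  exists k; apply: (leq_trans (leq_pmull k n_gt0)).
  have [->|k_gt0] := posnP k; first by rewrite muln0.
  by rewrite -[leqLHS]expn1 leq_pexp2l ?muln_gt0 ?n_gt0.
case: (ex_minnP ex_t) => t kt t_min.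
apply: (leq_trans kt); rewrite leq_exp2r // leq_mul2l; apply/orP; right.
set u := up_log 2 t.
have tu : t <= 2 ^ u by apply: up_logP.
pose L := 1 + l + n * (l + u); pose L' := 1 + l.
have kL : 2 * (n * k) <= 2 ^ L.
  rewrite /L -addnA expnD leq_mul2l /= expnD leq_mul //.
  apply: (leq_trans kt); rewrite [n * (l + u)]mulnC expnM leq_exp2r // expnD.
  by rewrite leq_mul.
have nL' : 2 * n <= 2 ^ L' by rewrite expnD leq_mul2l /=.
have [->|t_gt0] := posnP t; first by [].
have lt_k : (n * t.-1) ^ n < k.
  rewrite ltnNge; apply/negP => /t_min; lia.
have := leq_trans lt_k (k_le L L' kL nL'); rewrite ltn_exp2r // => lt_max.
have t_le : t <= M * (4 * l + u).
  have: n * t.-1 < n * (1 + M * (1 + 2 * l + u)).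
    apply: (leq_trans lt_max); rewrite geq_max /L /L'; apply/andP; split; nia.
  rewrite ltn_pmul2l // => t_lt.
  have: M + M * (1 + 2 * l + u) <= M * (4 * l + u).
    by rewrite -mulnS leq_mul2l; lia.
  lia.
have tM : t <= 5 * M * maxn l u.
  apply: (leq_trans t_le); rewrite -mulnA mulnCA leq_mul2l; lia.
have [u_le|u_gt] := leqP u l.
  rewrite (maxn_idPl u_le) in tM; apply: (leq_trans tM).
  rewrite leq_mul2r; apply/orP; right; apply: leq_mul => //.
  by rewrite -[leqLHS]expn1 leq_pexp2l.
have t_gt1 : 1 < t.
  rewrite ltnNge; apply/negP => t_le1; move: u_gt.
  by rewrite (eqP (_ : u == 0)) // up_log_eq0 t_le1.
have ut : 2 ^ u.-1 < t by apply: up_log_gtn.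
rewrite (maxn_idPr (ltnW u_gt)) in tM.
have u_gt0 : 0 < u by lia.
have u_lt : u < 20 * M.
  have := sqr_le_exp2S u; rewrite -{3}(prednK u_gt0) !expnS => u_sq.
  have: u * u < u * (20 * M) by lia.
  by rewrite ltn_pmul2l.
apply: (leq_trans tM); apply: (leq_trans (n := 5 * M * (20 * M))).
  by rewrite leq_mul2l (ltnW u_lt) orbT.
have -> : 5 * M * (20 * M) = 100 * M ^ 2 by rewrite expnS expn1; lia.
by rewrite leq_pmulr.
Qed.

Lemma progression_size (n M a d k : nat) (S : 'I_n -> set nat) :
  0 < M -> 1 < n -> 0 < d ->
  (forall i x, 0 < x -> few_in (S i) M x (2 * x)) ->
  (forall j, j < k -> sumset S (a + j * d)) ->
  k <= (n * (100 * M ^ 2 * up_log 2 n)) ^ n.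
Proof.
move=> M_gt0 n_gt1 d_gt0 sparse inS.
apply: bootstrap_bound => // L L' kL nL'.
pose X := [seq a + j * d | j <- iota 0 k].
have <- : size X = k by rewrite size_map size_iota.
have mem_X m : m \in X -> exists2 j, j < k & m = a + j * d.
  by case/mapP => j; rewrite mem_iota add0n => /andP[_ j_lt] ->; exists j.
have := @sumset_count n d S (ltnW n_gt1) d_gt0 M k L L' sparse kL nL'
  [set: 'I_n]%SET a 0 X.
rewrite cardsT card_ord; apply.
- rewrite /spaced pairwise_map.
  have: pairwise ltn (iota 0 k).
    by rewrite -sorted_pairwise ?iota_ltn_sorted //; apply: ltn_trans.
  apply: sub_pairwise => j j' /= lt_jj'.
  by rewrite -addnA leq_add2l addnC -mulSn leq_mul2r lt_jj' orbT.
- by move=> m /mem_X[j j_lt ->]; rewrite leq_addr ltn_add2l ltn_pmul2r.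
- move=> m /mem_X[j /inS[x xS ->] ->]; exists x => //.
  by rewrite add0n; apply: eq_bigl => i; rewrite inE.
Qed.

(** * Passing to the reals *)

Local Open Scope classical_set_scope.
Local Open Scope ring_scope.

Lemma log_sparse_few_in (R : realType) (C : R) (A : set nat) (x : nat) :
  log_sparse C A -> (0 < x)%N -> few_in A (Num.trunc C).+1 x (2 * x).
Proof.
move=> sparseA x_gt0.
set B := A `&` [set m | (x <= m < 2 * x)%N].
have finB : finite_set B.
  apply: (@sub_finite_set _ _ [set` iota 0 (2 * x)]); last exact: finite_seq.
  by move=> m [_ /= m_in]; rewrite mem_iota; lia.
exists (fset_set B).
  have := le_lt_trans (sparseA x x_gt0) (truncnS_gt C).
  by rewrite ltr_nat => /ltnW.
by move=> y Ay y_in; rewrite in_fset_set // inE.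
Qed.

Lemma card_fset_set_progression (a d k : nat) :
  (#|` fset_set [set (a + i * d)%N | i in `I_k]| <= k)%N.
Proof.
have -> : [set (a + i * d)%N | i in `I_k] =
          [set` [seq (a + i * d)%N | i <- iota 0 k]].
  apply/seteqP; split=> m /=.
    by case=> i /= i_lt <-; apply/mapP; exists i; rewrite ?mem_iota.
  by case/mapP => i; rewrite mem_iota => /andP[_ i_lt] ->; exists i.
set s := map _ _; have <- : size s = k by rewrite size_map size_iota.
apply: uniq_leq_size; first exact: fset_uniq.
by move=> m; rewrite in_fset_set ?inE //; apply: finite_seq.
Qed.

(** The exponent is made for [x `^ (log2 (log2 x) / log2 x) = log2 x], so the
    error factor of the theorem is a power of [log2 x]. *)
Lemma powR_log2_ratio (R : realType) (x : R) (K n : nat) :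
  1 < x -> 1 < log2 x ->
  x `^ ((1 + K%:R * (log2 (log2 x) / log2 x)) * n%:R) =
  (x * log2 x ^+ K) ^+ n.
Proof.
move=> x_gt1 l_gt1.
have x_gt0 : 0 < x by apply: lt_trans x_gt1.
have l_gt0 : 0 < log2 x by apply: lt_trans l_gt1.
have ln2_gt0 : 0 < ln 2 :> R by apply: ln_gt0; rewrite ltr1n.
have base : x `^ (log2 (log2 x) / log2 x) = log2 x.
  rewrite /powR gt_eqF //.
  have -> : log2 (log2 x) / log2 x * ln x = ln (log2 x).
    have -> : ln x = log2 x * ln 2 by rewrite /log2 divfK ?gt_eqF.
    by rewrite mulrA divfK ?gt_eqF // /log2 divfK // gt_eqF.
  by rewrite lnK.
rewrite powRrM powR_mulrn ?powR_ge0 // powRD; last first.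
  by rewrite (gt_eqF x_gt0) implybT.
by rewrite powRr1 1?ltW // [K%:R * _]mulrC powRrM base powR_mulrn 1?ltW.
Qed.

Lemma up_log_le_log2 (R : realType) (n : nat) : (1 < n)%N ->
  (up_log 2 n)%:R <= log2 n%:R + 1 :> R.
Proof.
move=> n_gt1.
have ln2_gt0 : 0 < ln 2 :> R by apply: ln_gt0; rewrite ltr1n.
have u_gt0 : (0 < up_log 2 n)%N by rewrite up_log_gt0.
rewrite -(prednK u_gt0) -natr1 lerD2r /log2 ler_pdivlMr // mulr_natl -lnXn //.
rewrite -natrX ler_ln ?posrE ?ltr0n ?expn_gt0 //; last by rewrite ltnW.
by rewrite ler_nat ltnW // up_log_gtn.
Qed.

Theorem theorem2p1 (R : realType) (C : R) (C_gt0 : 0 < C) :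
  exists (K : R) (n0 : nat), 0 < K /\ (3 <= n0)%N /\
    forall (n : nat), (n0 <= n)%N ->
    forall S : 'I_n -> set nat,
      (forall i, S i `<=` [set m | (0 < m)%N]) ->
      (forall i, log_sparse C (S i)) ->
    forall T : set nat,
      arithmetic_progression T -> T `<=` sumset S ->
      (#|` fset_set T|)%:R
        <= n%:R `^ ((1 + K * (log2 (log2 n%:R) / log2 n%:R)) * n%:R).
Proof.
(* [A] absorbs the factor 2 of [up_log 2 n <= 2 * log2 n]; the exponent [A.+1]
   works because [A * l <= 2 ^ A * l <= l ^ A.+1] when [2 <= l], that is, when
   [4 <= n]. *)
set M := (Num.trunc C).+1; pose A := (200 * M ^ 2)%N.
exists (A.+1)%:R, 4%N; split; first by rewrite ltr0n.
split=> // n n_ge4 S _ sparse T [a [d [k [d_gt0 T_eq]]]] TS.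
have n_gt1 : (1 < n)%N by apply: leq_trans n_ge4.
have ln2_gt0 : 0 < ln 2 :> R by apply: ln_gt0; rewrite ltr1n.
have l_ge2 : 2 <= log2 n%:R :> R.
  rewrite /log2 ler_pdivlMr // mulr_natl -lnXn //.
  by rewrite -natrX ler_ln ?posrE ?ltr0n ?ler_nat // ltnW.
have k_le : (k <= (n * (100 * M ^ 2 * up_log 2 n)) ^ n)%N.
  apply: (@progression_size n M a d k S) => //.
    by move=> i x x_gt0; apply: log_sparse_few_in.
  by move=> j j_lt; apply: TS; rewrite T_eq; exists j.
rewrite powR_log2_ratio ?ltr1n //; last first.
  by apply: lt_le_trans l_ge2; rewrite ltr1n.
apply: le_trans (_ : (n * (100 * M ^ 2 * up_log 2 n))%:R ^+ n <= _).
  rewrite -natrX ler_nat T_eq.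
  exact: leq_trans (card_fset_set_progression a d k) k_le.
set l := log2 _ in l_ge2 *.
have l_ge0 : 0 <= l by apply: le_trans l_ge2.
apply: lerXn2r; rewrite ?nnegrE ?ler0n //.
  by rewrite mulr_ge0 // exprn_ge0.
rewrite natrM ler_wpM2l ?ler0n //.
have u_le : (up_log 2 n)%:R <= 2 * l.
  apply: le_trans (up_log_le_log2 R n_gt1) _.
  by rewrite mulr_natl mulr2n lerD2l (le_trans _ l_ge2) // ler1n.
rewrite natrM (le_trans (ler_wpM2l (ler0n _ _) u_le)) //.
rewrite mulrA -natrM exprSr ler_wpM2r //.
have -> : (100 * M ^ 2 * 2)%N = A by rewrite /A; lia.
apply: le_trans (_ : 2 ^+ A <= _); last by rewrite lerXn2r ?nnegrE.
by rewrite -natrX ler_nat ltnW // ltn_expl.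
Qed.
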